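(* Let $P^N\in\mathcal M^{np,N}$ be realizable under $(\mathcal Q_\beta,s)$. Then $$\Psi^{+,N}(P^N)=\sup_{(K,q,\beta)\in\mathcal C^N(P^N)}\ \sum_{k=1}^Kq_k\,g(\beta_k),$$ where $$\mathcal C^N(P^N)=\Big\{(K,q,\beta): K\in\mathbb N,\ K\le\tilde L^N+2,\ q\in\Delta_K,\ \beta=(\beta_1,\dots,\beta_K)\in\mathcal B^K,\ \sum_{k=1}^Kq_k\,t^N(\beta_k)=b^N(P^N)\Big\}.$$
   Context: Write $[m]=\{1,\dots,m\}$, $\mathbb N=\{1,2,\dots\}$, $\Delta_K=\{q\in[0,1]^K:\sum_kq_k=1\}$. Let $J,T\ge 1$ be integers and $\mathcal A_T=\{A_1\times\cdots\times A_T: \varnothing\neq A_t\subseteq[J]\}$. For an integer $N\ge1$ fix a design $a_1^N,\dots,a_N^N\in\mathcal A_T$, let $\mathcal Y^N=a_1^N\times\cdots\times a_N^N$ and let $\mathcal M^{np,N}$ be the set of all probability measures on the finite set $\mathcal Y^N$. Let $(\mathcal B,\mathscr B)$ be a measurable space and $\mathcal Q_\beta$ the set of all probability measures on it. A choice kernel is a measurable map $s:\mathcal B\times\mathcal A_T\times[J]^T\to[0,1]$ (discrete $\sigma$-algebras on the finite factors) with $s(\beta,a,y)=0$ if $y\notin a$ and $\sum_{y\in a}s(\beta,a,y)=1$ for all $(\beta,a)$; fix one. For $Q_\beta\in\mathcal Q_\beta$, $P^{F,s,N}(Q_\beta)$ is the law of pairs $(\beta_i,Y_i)_{i\in[N]}$,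 independent across $i$, with $\beta_i\sim Q_\beta$ and $\mathbb P(Y_i=y\mid\beta_i)=s(\beta_i,a_i^N,y)$; $M_{\mathcal Y^N}$ maps such a law to the marginal law of $(Y_1,\dots,Y_N)$, so $M_{\mathcal Y^N}(P^{F,s,N}(Q_\beta))(y_1,\dots,y_N)=\prod_{i=1}^N\int_{\mathcal B} s(\beta,a_i^N,y_i)\,dQ_\beta(\beta)$. $P^N\in\mathcal M^{np,N}$ is realizable under $(\mathcal Q_\beta,s)$ if $P^N=M_{\mathcal Y^N}(P^{F,s,N}(Q_\beta))$ for some $Q_\beta\in\mathcal Q_\beta$. Let $g:\mathcal B\to[0,1]$ be measurable and $\Psi^{+,N}(P^N)=\sup\{\int g\,dQ_\beta: Q_\beta\in\mathcal Q_\beta,\ M_{\mathcal Y^N}(P^{F,s,N}(Q_\beta))=P^N\}$. Let $\mathcal D^N=\{(a,y):a\in\{a_1^N,\dots,a_N^N\},y\in a\}$, $n_a=\#\{i\in[N]:a_i^N=a\}$, and let $Q^{np,N}_{Y\mid a}(P^N)(a,y)=\frac1{n_a}\sum_{i:a_i^N=a}P^N_i(y)$ where $P^N_i$ is the $i$-th marginal of $P^N$. Let $L^N=\#\mathcal D^N$, let $(a(l),y(l))_{l\in[L^N]}$ be an ordering of $\mathcal D^N$, and $t_l^N(\beta)=s(\beta,a(l),y(l))$. Let $\tilde L^N+1$ be the maximal cardinality of a linearly independent subset of the functions $\{1,t_1^N,\dots,t^N_{L^N}\}$ on $\mathcal B$, with the ordering chosen so that $1,t_1^N,\dots,t^N_{\tilde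 L^N}$ is such a subset. Put $t^N=(t_1^N,\dots,t^N_{\tilde L^N})^\top$ and $b^N(P^N)=(Q^{np,N}_{Y\mid a}(P^N)(a(l),y(l)))_{l=1}^{\tilde L^N}$. *)

(* Defs.v *)
From HB Require Import structures.
From mathcomp Require Import all_boot all_order all_algebra.
From mathcomp Require Import all_classical all_reals all_analysis.
From mathcomp Require Import measurable_realfun.

Set Implicit Arguments.
Unset Strict Implicit.
Unset Printing Implicit Defensive.

Import Order.TTheory GRing.Theory Num.Theory.

Local Open Scope classical_set_scope.
Local Open Scope ring_scope.

(* There are J.+1 alternatives and T.+1 periods: both numbers are at least 1, and
   the successor form makes the finite types below inhabited, as the library
   requires of measurable types.  A profile is an element of [J]^T, and menu J T
   is the collection A_T of products A_1 x ... x A_T of nonempty sets. *)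
Definition profile (J T : nat) := {ffun 'I_T.+1 -> 'I_J.+1}.

HB.instance Definition _ J T := Finite.on (profile J T).
HB.instance Definition _ J T := isPointed.Build (profile J T) [ffun=> ord0].
HB.instance Definition _ J T := @isMeasurable.Build default_measure_display
  (profile J T) discrete_measurable discrete_measurable0
  discrete_measurableC discrete_measurableU.

Definition is_menu J T (A : {set profile J T}) : bool :=
  [exists F : {ffun 'I_T.+1 -> {set 'I_J.+1}},
    [forall t, F t != finset.set0] &&
    (A == [set y : profile J T | [forall t, (y : {ffun _ -> _}) t \in F t]]%SET)].

Record menu (J T : nat) := Menu {
  menu_set :> {set profile J T};
  _ : is_menu menu_set }.

HB.instance Definition _ J T := [isSub for @menu_set J T].
HB.instance Definition _ J T := [Finite of menu J T by <:].

Lemma is_menuT J T : is_menu (finset.setTfor (profile J T)).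
Proof.
apply/existsP; exists [ffun=> finset.setTfor 'I_J.+1]; apply/andP; split.
  by apply/forallP => t; rewrite ffunE; apply/set0Pn; exists ord0; rewrite inE.
apply/eqP/setP => y; rewrite !inE; apply/esym/forallP => t.
by rewrite ffunE inE.
Qed.

HB.instance Definition _ J T := isPointed.Build (menu J T) (Menu (is_menuT J T)).
HB.instance Definition _ J T := @isMeasurable.Build default_measure_display
  (menu J T) discrete_measurable discrete_measurable0
  discrete_measurableC discrete_measurableU.

Record choice_kernel (R : realType) d (B : measurableType d) (J T : nat) :=
  ChoiceKernel {
    ck :> B * menu J T * profile J T -> R;
    ck_measurable : measurable_fun [set: B * menu J T * profile J T] ck;
    ck_ge0 : forall x, 0 <= ck x;
    ck_le1 : forall x, ck x <= 1;
    ck_out : forall b (a : menu J T) y, y \notin (a : {set _}) ->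
      ck (b, a, y) = 0;
    ck_sum : forall b (a : menu J T),
      \sum_(y in (a : {set _})) ck (b, a, y) = 1 }.

Section indep_law.
Context (R : realType) d (X : measurableType d).
Local Open Scope ereal_scope.

Definition tcons n (z : X * n.-tuple X) : n.+1.-tuple X := [tuple of z.1 :: z.2].

Lemma measurable_tcons n : measurable_fun [set: X * n.-tuple X] (@tcons n).
Proof.
exact: (@measurable_cons _ _ _ _ fst _ snd measurable_fst measurable_snd).
Qed.

Section tcons_law.
Context n (p : probability X R) (q : probability (n.-tuple X) R).

Definition tcons_law : set (n.+1.-tuple X) -> \bar R :=
  pushforward (p \x q) (@tcons n).

Let tcons_law0 : tcons_law set0 = 0.
Proof. by rewrite /tcons_law /pushforward preimage_set0 measure0. Qed.

Let tcons_law_ge0 A : 0 <= tcons_law A.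
Proof. by rewrite /tcons_law /pushforward; exact: measure_ge0. Qed.

Let tcons_law_additive : semi_sigma_additive tcons_law.
Proof.
move=> F mF tF mUF; rewrite /tcons_law /pushforward preimage_bigcup.
apply: measure_semi_sigma_additive.
- by move=> i; rewrite -[X in measurable X]setTI; exact: measurable_tcons.
- apply/trivIsetP => /= i j _ _ ij; rewrite -preimage_setI.
  by move/trivIsetP : tF => /(_ _ _ _ _ ij) ->//; rewrite preimage_set0.
- by rewrite -preimage_bigcup -[X in measurable X]setTI; exact: measurable_tcons.
Qed.

HB.instance Definition _ := isMeasure.Build _ _ _ tcons_law
  tcons_law0 tcons_law_ge0 tcons_law_additive.

Let tcons_lawT : tcons_law [set: _] = 1.
Proof. by rewrite /tcons_law /pushforward preimage_setT probability_setT. Qed.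

HB.instance Definition _ :=
  Measure_isProbability.Build _ _ _ tcons_law tcons_lawT.

End tcons_law.

(* The product measure on X^n of n possibly different probabilities: the law
   of an n-tuple with independent coordinates and i-th marginal p i. *)
Fixpoint indep_law n : ('I_n -> probability X R) -> probability (n.-tuple X) R :=
  match n with
  | 0 => fun _ => dirac [tuple]
  | n'.+1 => fun p => tcons_law (p ord0) (indep_law (fun i => p (lift ord0 i)))
  end.

Lemma indep_law_rect n (p : 'I_n -> probability X R) (A : 'I_n -> set X) :
  (forall i, measurable (A i)) ->
  indep_law p [set w | forall i, A i (tnth w i)] = \prod_(i < n) p i (A i).
Proof.
elim: n p A => [|n IH] p A mA.
  rewrite big_ord0 /= diracE mem_set//; first by case.
rewrite big_ord_recl /= /tcons_law /pushforward.
rewrite -[X in _ = _ * X](IH (fun i => p (lift ord0 i)) (fun i => A (lift ord0 i)))//.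
rewrite -product_measure1E//; last first.
  rewrite (_ : mkset _ = \bigcap_(i in [set: 'I_n]) ((@tnth _ _ ^~ i) @^-1` A (lift ord0 i))).
    apply: fin_bigcap_measurable => // i _; rewrite -[X in measurable X]setTI.
    exact: measurable_tnth.
  by apply/seteqP; split => w /= h i; [move=> _|]; exact: h.
congr (_ _); apply/seteqP; split => -[x w] /=.
  move=> h; split; first exact: (h ord0).
  by move=> i; have := h (lift ord0 i); rewrite tnthS.
move=> [h0 h] i; case: (unliftP ord0 i) => [j ->|->//]; rewrite tnthS; exact: h.
Qed.

End indep_law.

Section model.
Context (R : realType) d (B : measurableType d) (J T : nat)
  (s : choice_kernel R B J T).
Local Open Scope ereal_scope.

(* Law of (beta, Y) where beta ~ Q and Y given beta has mass function
   s (beta, a, .); section_mass E b is the conditional probability of E given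
   beta = b. *)
Section pair_law.
Context (Q : probability B R) (a : menu J T).
Implicit Type E : set (B * profile J T).

Definition section_mass E (b : B) : R :=
  (\sum_(y : profile J T) s (b, a, y) * \1_E (b, y))%R.

Definition pair_law E : \bar R := \int[Q]_b (section_mass E b)%:E.

Let measurable_section E : measurable E ->
  measurable_fun [set: B] (section_mass E).
Proof.
move=> mE; apply: measurable_sum => y; apply: measurable_funM.
  apply: (@measurableT_comp _ _ _ _ _ _ s _ (fun b => (b, a, y))).
    exact: ck_measurable.
  by apply: measurable_fun_pair => //; exact: measurable_fun_pair.
apply: (@measurableT_comp _ _ _ _ _ _ (\1_E : _ -> R) _ (fun b => (b, y))).
  exact: measurable_indic.
exact: measurable_fun_pair.
Qed.

Let section_mass_ge0 E b : (0 <= section_mass E b)%R.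
Proof. by rewrite sumr_ge0// => y _; rewrite mulr_ge0// ck_ge0. Qed.

Let pair_law0 : pair_law set0 = 0.
Proof.
apply: integral0_eq => b _; rewrite /section_mass big1// => y _.
by rewrite indic0 mulr0.
Qed.

Let pair_law_ge0 E : 0 <= pair_law E.
Proof. by apply: integral_ge0 => b _; rewrite lee_fin. Qed.

Let pair_law_additive : semi_sigma_additive pair_law.
Proof.
move=> F mF tF mUF.
have -> : pair_law (\bigcup_n F n) = \sum_(0 <= i <oo) pair_law (F i).
  rewrite /pair_law -integral_nneseries//; last 2 first.
  - by move=> n; apply/measurable_EFinP; exact: measurable_section.
  - by move=> n b _; rewrite lee_fin.
  apply: eq_integral => b _; rewrite /section_mass.
  under [RHS]eq_eseriesr => i _ do rewrite -sumEFin.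
  rewrite nneseries_sum; last first.
    by move=> y i _; rewrite lee_fin mulr_ge0// ck_ge0.
  rewrite -sumEFin; apply: eq_bigr => y _.
  rewrite EFinM indic_bigcup// -nneseriesZl; last by move=> i _; rewrite lee_fin.
  by apply: eq_eseriesr => i _; rewrite EFinM.
by apply: is_cvg_nneseries => i _ _; exact: pair_law_ge0.
Qed.

HB.instance Definition _ := isMeasure.Build _ _ _ pair_law
  pair_law0 pair_law_ge0 pair_law_additive.

Let pair_lawT : pair_law [set: _] = 1.
Proof.
rewrite /pair_law -(probability_setT Q) -[RHS]mul1e -integral_cst//.
apply: eq_integral => b _ /=; congr EFin; rewrite /section_mass.
rewrite -(ck_sum s b a) [RHS]big_mkcond/=; apply: eq_bigr => y _.
by rewrite indicT mulr1; case: ifPn => // ya; rewrite ck_out.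
Qed.

HB.instance Definition _ :=
  Measure_isProbability.Build _ _ _ pair_law pair_lawT.

End pair_law.

Context (N : nat) (a : 'I_N -> menu J T).

(* P^{F,s,N}(Q), a law on (B * [J]^T)^N *)
Definition full_law (Q : probability B R) :
    probability (N.-tuple (B * profile J T)) R :=
  indep_law (fun i => pair_law Q (a i)).

(* M_{Y^N}: the marginal law of (Y_1, ..., Y_N) *)
Definition choice_marginal (PF : probability (N.-tuple (B * profile J T)) R) :
    set (N.-tuple (profile J T)) -> \bar R :=
  pushforward PF (fun w => [tuple (tnth w i).2 | i < N]).

Lemma choice_marginalE (Q : probability B R) (y : N.-tuple (profile J T)) :
  choice_marginal (full_law Q) [set y] =
  \prod_(i < N) \int[Q]_b (s (b, a i, tnth y i))%:E.
Proof.
rewrite /choice_marginal /pushforward.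
rewrite (_ : _ @^-1` _ = [set w : N.-tuple (B * profile J T) |
    forall i, (snd @^-1` [set tnth y i]) (tnth w i)]); last first.
  apply/seteqP; split => w /=.
    by move=> <- i; rewrite tnth_mktuple.
  by move=> h; apply/eq_from_tnth => i; rewrite tnth_mktuple h.
rewrite /full_law.
rewrite (@indep_law_rect _ _ _ N _ (fun i => snd @^-1` [set tnth y i])); last first.
  by move=> i; rewrite -[X in measurable X]setTI; exact: measurable_snd.
apply: eq_bigr => i _; apply: eq_integral => b _; congr EFin.
rewrite /section_mass (bigD1 (tnth y i))//= big1 ?addr0.
  by rewrite indicE mem_set// mulr1.
by move=> z zy; rewrite indicE memNset ?mulr0//=; apply/eqP.
Qed.

(* Y^N = a_1 x ... x a_N; a probability measure on Y^N is represented by a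
   probability on ([J]^T)^N that gives mass 1 to choice_space. *)
Definition choice_space : set (N.-tuple (profile J T)) :=
  [set y | forall i, tnth y i \in (a i : {set _})].

Definition generates (Q : probability B R)
    (P : probability (N.-tuple (profile J T)) R) : Prop :=
  forall A, measurable A -> choice_marginal (full_law Q) A = P A.

Definition realizable (P : probability (N.-tuple (profile J T)) R) : Prop :=
  exists Q : probability B R, generates Q P.

Definition Psi_plus (g : B -> R) (P : probability (N.-tuple (profile J T)) R) :
    \bar R :=
  ereal_sup [set \int[Q]_b (g b)%:E | Q in [set Q | generates Q P]].

(* D^N: the pairs (a, y) with a in {a_1, ..., a_N} and y in a. *)
Definition design_cells : {set menu J T * profile J T} :=
  [set ay | (ay.1 \in codom a) && (ay.2 \in (ay.1 : {set _}))]%SET.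

(* Q^{np,N}_{Y|a}(P)(a, y): the average over {i | a_i = a}, of cardinality n_a,
   of the i-th marginal of P at y. *)
Definition Qnp (P : probability (N.-tuple (profile J T)) R)
    (ay : menu J T * profile J T) : R :=
  ((#|[set i | a i == ay.1]%SET|%:R)^-1 *
   \sum_(i < N | a i == ay.1)
     fine (pushforward P (fun z => tnth z i) [set ay.2]%classic))%R.

End model.

Definition lin_indep (R : nzRingType) (V : lmodType R) (vs : seq V) : Prop :=
  forall c : 'I_(size vs) -> R,
    \sum_i c i *: vs`_i = 0 -> forall i, c i = 0.

(* n is the maximal cardinality of a linearly independent subset of S; the
   entries of a linearly independent sequence are pairwise distinct, so that
   its size is the cardinality of the subset it enumerates. *)
Definition max_indep_card (R : nzRingType) (V : lmodType R) (S : set V)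
    (n : nat) : Prop :=
  (exists vs : seq V,
     [/\ forall v, v \in vs -> S v, lin_indep vs & size vs = n]) /\
  (forall vs : seq V,
     (forall v, v \in vs -> S v) -> lin_indep vs -> (size vs <= n)%N).

Section moments.
Context (R : realType) d (B : measurableType d) (J T N : nat)
  (s : choice_kernel R B J T) (a : 'I_N -> menu J T).
Local Notation L := #|design_cells a|.
Implicit Types (o : 'I_L -> menu J T * profile J T) (Lt : nat).

Definition is_ordering o : Prop :=
  injective o /\ codom o =i design_cells a.

Definition moment_fun o (l : 'I_L) : B -> R :=
  fun b => s (b, (o l).1, (o l).2).

(* Lt stands for L-tilde: Lt + 1 is the maximal cardinality of a linearly
   independent subset of {1, t_1, ..., t_L}, and 1, t_1, ..., t_Lt is such a
   subset. *)
Definition basis_ordering o Lt (hLt : (Lt <= L)%N) : Prop :=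
  max_indep_card
    [set f : B -> R | f = cst 1 \/ exists l, f = moment_fun o l] Lt.+1 /\
  lin_indep
    ((cst 1 : B -> R) ::
     [seq moment_fun o (widen_ord hLt l) | l <- enum 'I_Lt]).

Definition tN o Lt (hLt : (Lt <= L)%N) (b : B) : 'cV[R]_Lt :=
  \col_(l < Lt) moment_fun o (widen_ord hLt l) b.

Definition bN o Lt (hLt : (Lt <= L)%N)
    (P : probability (N.-tuple (profile J T)) R) : 'cV[R]_Lt :=
  \col_(l < Lt) Qnp a P (o (widen_ord hLt l)).

Definition simplex K (q : 'I_K -> R) : Prop :=
  (forall k, 0 <= q k <= 1) /\ \sum_k q k = 1.

(* (K, q, beta) belongs to C^N(P) *)
Definition candidate o Lt (hLt : (Lt <= L)%N)
    (P : probability (N.-tuple (profile J T)) R)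
    K (q : 'I_K -> R) (beta : 'I_K -> B) : Prop :=
  [/\ (1 <= K <= Lt + 2)%N, simplex q &
      \sum_k q k *: tN o hLt (beta k) = bN o hLt P].

End moments.

(* Main.v *)
Require Import Defs.
From HB Require Import structures.
From mathcomp Require Import all_boot all_order all_algebra.
From mathcomp Require Import all_classical all_reals all_analysis.
From mathcomp Require Import measurable_realfun.

(* For every law Q of beta, the mean of a bounded measurable map
   f : B -> R^n is an exact (not merely approximate) convex combination of values
   of f.  Applied to (t_1, ..., t_Lt, g), with Caratheodory's bound of Lt + 2
   points, this turns a Q generating P into an element of C^N(P) with the same
   value of g.  Conversely an element of C^N(P) is a finitely supported law whose
   integrals of t_1, ..., t_Lt agree with those of any Q generating P; since all
   the cell functions s(., a_i, y) lie in the span of 1, t_1, ..., t_Lt (or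
   vanish), all marginal choice probabilities agree, hence so does the law of
   (Y_1, ..., Y_N).

   Exactness is obtained without a separating hyperplane, by induction on n.
   Suppose f has mean zero on D and let h be one of its coordinates.  If h is
   a.e. zero on D, restrict to {h = 0} and drop h.  Otherwise
   F(x, y) = - h(y) f(x) + h(x) f(y) on {h >= 0} x {h < 0} has mean zero for the
   product law, its h-coordinate vanishes identically, and each F(x, y) is a
   nonnegative, nontrivial combination of f(x) and f(y). *)

Set Implicit Arguments.
Unset Strict Implicit.
Unset Printing Implicit Defensive.

Import Order.TTheory GRing.Theory Num.Theory.
Import numFieldNormedType.Exports.

Local Open Scope classical_set_scope.
Local Open Scope ring_scope.

(** * Bounded measurable functions and their integrals *)

Definition bounded_measurable (R : realType) d (X : measurableType d)
    (f : X -> R) : Prop :=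
  measurable_fun [set: X] f /\ exists M, forall x, `|f x| <= M.

Section bounded_measurable.
Context (R : realType) d (X : measurableType d).
Implicit Types (f h : X -> R) (A : set X) (mu : probability X R).

Lemma bmeas_integrable mu A f : measurable A -> bounded_measurable f ->
  mu.-integrable A (EFin \o f).
Proof.
move=> mA [mf [M fM]]; apply: measurable_bounded_integrable => //.
- exact: (le_lt_trans (probability_le1 _ mA) (ltry _)).
- exact: measurable_funTS.
- by exists M; split; [exact: num_real|move=> y My x _; exact/(le_trans (fM x))/ltW].
Qed.

Lemma bmeasD f h : bounded_measurable f -> bounded_measurable h ->
  bounded_measurable (fun x => f x + h x).
Proof.
move=> [mf [M fM]] [mh [L hL]]; split; first exact: measurable_funD.
by exists (M + L) => x; rewrite (le_trans (ler_normD _ _))// lerD.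
Qed.

Lemma bmeasM f h : bounded_measurable f -> bounded_measurable h ->
  bounded_measurable (fun x => f x * h x).
Proof.
move=> [mf [M fM]] [mh [L hL]]; split; first exact: measurable_funM.
by exists (M * L) => x; rewrite normrM ler_pM.
Qed.

Lemma bmeas_cst r : bounded_measurable (cst r : X -> R).
Proof. by split; [exact: measurable_cst|exists `|r|]. Qed.

Lemma bmeasN f : bounded_measurable f -> bounded_measurable (fun x => - f x).
Proof.
move=> /(bmeasM (bmeas_cst (-1))); congr bounded_measurable.
by apply/funext => x; rewrite /cst mulN1r.
Qed.

Lemma bmeas_patch A f : measurable A -> bounded_measurable f ->
  bounded_measurable (f \_ A).
Proof.
move=> mA fb; have [mf [M fM]] := fb; split.
  by apply/(measurable_restrictT _ _).1 => //; exact: measurable_funTS.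
exists `|M| => x; rewrite patchE; case: ifPn => _.
  by rewrite (le_trans (fM x))// ler_norm.
by rewrite normr0.
Qed.

Lemma bmeas_comp d' (Z : measurableType d') (p : Z -> X) f :
  measurable_fun [set: Z] p -> bounded_measurable f ->
  bounded_measurable (fun z => f (p z)).
Proof.
move=> mp [mf [M fM]]; split; last by exists M => z; exact: fM.
exact: measurableT_comp.
Qed.

Lemma Rintegral_prob_cst mu (r : R) : \int[mu]_x r = r.
Proof.
rewrite (Rintegral_cst _ measurableT).
have -> : fine ((mu : {measure set X -> \bar R}) [set: X]) = 1.
  exact: (congr1 fine (probability_setT mu)).
exact: mulr1.
Qed.

Lemma Rintegral_disjU mu A A' f : measurable A -> measurable A' ->
  A `&` A' = set0 -> bounded_measurable f ->
  \int[mu]_(x in A `|` A') f x = \int[mu]_(x in A) f x + \int[mu]_(x in A') f x.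
Proof.
move=> mA mA' AA' fb; rewrite Rintegral_setU//.
  by apply: bmeas_integrable => //; exact: measurableU.
exact/disj_set2P.
Qed.

Lemma Rintegral_null mu A f : measurable A -> mu A = 0%E ->
  bounded_measurable f -> \int[mu]_(x in A) f x = 0.
Proof.
move=> mA A0 [mf _]; rewrite /Rintegral null_set_integral//.
exact/measurable_EFinP/measurable_funTS.
Qed.

(** A nonnegative function with zero integral vanishes almost everywhere; as [h] vanishes nowhere on
    [A], the exceptional null set contains all of [A]. *)
Lemma Rintegral0_null mu A h : measurable A -> bounded_measurable h ->
  (forall x, A x -> 0 < h x) -> \int[mu]_(x in A) h x = 0 -> mu A = 0%E.
Proof.
move=> mA hb h0 int0.
have eint0 : (\int[mu]_(x in A) (h x)%:E = 0)%E.
  rewrite -[LHS]fineK; first by rewrite -/(Rintegral _ _ _) int0.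
  exact: (integrable_fin_num mA (bmeas_integrable mu mA hb)).
have : ae_eq mu A (EFin \o h) (cst 0%E).
  apply/ae_eq_integral_abs => //.
    by apply/measurable_EFinP/measurable_funTS; case: hb.
  by rewrite -[RHS]eint0; apply: eq_integral => x /set_mem/h0/ltW hx; rewrite gee0_abs.
move=> [N [mN N0 subN]]; apply/eqP; rewrite -measure_le0 -N0.
apply: le_measure; rewrite ?inE//.
move=> x Ax; apply: subN => /= /(_ Ax) [] hx0.
by have := h0 _ Ax; rewrite hx0 ltxx.
Qed.

End bounded_measurable.

(** Extending both factors by zero outside [A] and [A'] turns the integral over the rectangle into
    one over the whole product, where Fubini applies. *)
Lemma Rintegral_prodM (R : realType) d d' (X : measurableType d)
    (Y : measurableType d') (mu : probability X R) (nu : probability Y R)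
    A A' (f : X -> R) (h : Y -> R) : measurable A -> measurable A' ->
  bounded_measurable f -> bounded_measurable h ->
  \int[(mu \x nu)%E]_(z in A `*` A') (f z.1 * h z.2) =
    \int[mu]_(x in A) f x * \int[nu]_(y in A') h y.
Proof.
move=> mA mA' fb hb.
rewrite [LHS]Rintegral_mkcond [in RHS]Rintegral_mkcond [X in _ * X]Rintegral_mkcond.
have fAb := bmeas_patch mA fb; have hAb := bmeas_patch mA' hb.
transitivity (\int[(mu \x nu)%E]_z ((f \_ A) z.1 * (h \_ A') z.2)).
  apply: eq_Rintegral => -[x y] _ /=; rewrite !patchE in_setX/=.
  by case: (x \in A); case: (y \in A'); rewrite ?mulr0 ?mul0r.
have ib : (mu \x nu)%E.-integrable setT (fun z => ((f \_ A) z.1 * (h \_ A') z.2)%:E).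
  apply: (bmeas_integrable (mu \x nu)%E) => //; apply: bmeasM.
    exact: (bmeas_comp (@measurable_fst _ _ _ _) fAb).
  exact: (bmeas_comp (@measurable_snd _ _ _ _) hAb).
rewrite /Rintegral -integral12_prod_meas1// /fubini_F/=.
have ih := bmeas_integrable nu measurableT hAb.
have if_ := bmeas_integrable mu measurableT fAb.
under eq_integral => x _.
  under eq_integral do rewrite EFinM.
  rewrite (integralZl measurableT ih).
  over.
rewrite /= -(fineK (integrable_fin_num measurableT ih)).
rewrite (integralZr measurableT if_) fineM//.
exact: (integrable_fin_num measurableT if_).
Qed.

Lemma bmeas_sum (R : realType) d (X : measurableType d) (I : Type) (r : seq I)
    (f : I -> X -> R) : (forall i, bounded_measurable (f i)) ->
  bounded_measurable (fun x => \sum_(i <- r) f i x).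
Proof.
move=> fb; elim: r => [|i r IH].
  by under eq_fun do rewrite big_nil; exact: bmeas_cst.
by under eq_fun do rewrite big_cons; exact: bmeasD.
Qed.

Lemma Rintegral_affine (R : realType) d (X : measurableType d)
    (mu : probability X R) (I : finType) (c0 : R) (c : I -> R)
    (f : I -> X -> R) : (forall i, bounded_measurable (f i)) ->
  \int[mu]_x (c0 + \sum_i c i * f i x) = c0 + \sum_i c i * \int[mu]_x f i x.
Proof.
move=> fb.
have cfb i : bounded_measurable (fun x => c i * f i x).
  exact: bmeasM (bmeas_cst _ (c i)) (fb i).
rewrite RintegralD//; last 2 first.
  exact: (bmeas_integrable mu measurableT (bmeas_cst _ c0)).
  exact: (bmeas_integrable mu measurableT (bmeas_sum _ cfb)).
rewrite Rintegral_prob_cst; congr (_ + _).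
elim: (index_enum I) => [|i r IH].
  rewrite big_nil; under eq_Rintegral do rewrite big_nil.
  by rewrite Rintegral_prob_cst.
rewrite big_cons -IH; under eq_Rintegral do rewrite big_cons.
rewrite RintegralD//; last 2 first.
  exact: (bmeas_integrable mu measurableT (cfb i)).
  exact: (bmeas_integrable mu measurableT (bmeas_sum _ cfb)).
by rewrite RintegralZl//; exact: (bmeas_integrable mu measurableT (fb i)).
Qed.

(** * Means as exact finite convex combinations *)

Lemma zero_mean_atoms (R : realType) n : forall d (X : measurableType d)
    (mu : probability X R) (D : set X) (f : 'I_n -> X -> R),
  measurable D -> (0 < mu D)%E ->
  (forall i, bounded_measurable (f i)) ->
  (forall i, \int[mu]_(x in D) f i x = 0) ->
  exists s : seq (R * X),
    [/\ forall p, p \in s -> 0 <= p.1 /\ D p.2,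
        exists2 p, p \in s & 0 < p.1 &
        forall i, \sum_(p <- s) p.1 * f i p.2 = 0].
Proof.
(* The space varies in the induction, since the step passes from [X] to [X * X]. Weights are only
   required to be nonnegative and not all zero, so that they can be multiplied by values of [h];
   they are normalised later. *)
elim: n => [|n IH] d X mu D f mD D0 fb f0.
  have [x Dx] : exists x, D x.
    apply/not_existsP => D_empty; move: D0; rewrite (_ : D = set0) ?measure0 ?ltxx//.
    by apply/seteqP; split => // x /D_empty.
  exists [:: (1, x)]; split; last by case.
    by move=> p; rewrite inE => /eqP ->.
  by exists (1, x); rewrite ?inE.
pose h := f ord0; pose f' i := f (lift ord0 i).
have [mh _] := fb ord0.
have fb' i : bounded_measurable (f' i) by exact: fb.
have mE (P : set R) : measurable P -> measurable (D `&` h @^-1` P).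
  move=> mP; apply: measurableI => //; rewrite -[X in measurable X]setTI.
  exact: mh.
pose A := D `&` h @^-1` `[0, +oo[%classic.
pose A' := D `&` h @^-1` `]-oo, 0[%classic.
have [mA mA'] : measurable A /\ measurable A'.
  by split; apply: mE; exact: measurable_itv.
have Aval x : A x <-> D x /\ 0 <= h x.
  by rewrite /A /= in_itv/= andbT.
have A'val x : A' x <-> D x /\ h x < 0 by rewrite /A' /= in_itv.
have DE : D = A `|` A'.
  apply/seteqP; split => x; last by case=> [/Aval|/A'val] [].
  by move=> Dx; have [hx|hx] := leP 0 (h x); [left; apply/Aval|right; apply/A'val].
have AA' : A `&` A' = set0.
  by apply/seteqP; split => x // [/Aval [_ hx] /A'val[_]]; rewrite ltNge hx.
have splitA k : bounded_measurable k ->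
    \int[mu]_(x in D) k x = \int[mu]_(x in A) k x + \int[mu]_(x in A') k x.
  by move=> kb; rewrite DE Rintegral_disjU.
have hb : bounded_measurable h by exact: fb.
have h0 : \int[mu]_(x in D) h x = 0 by exact: f0.
have muU S S' : measurable S -> measurable S' -> S `&` S' = set0 ->
    mu (S `|` S') = (mu S + mu S')%E by exact: measureU.
(* If [h] is almost everywhere nonnegative on [D], its zero mean makes [U] null as well, so [Z]
   carries all the mass of [D]. *)
have [A'0|A'pos] := eqVneq (mu A') 0%E.
  pose Z := D `&` h @^-1` [set 0].
  pose U := D `&` h @^-1` `]0, +oo[%classic.
  have [mZ mU] : measurable Z /\ measurable U.
    by split; apply: mE => //; exact: measurable_itv.
  have Uval x : U x <-> D x /\ 0 < h x by rewrite /U /= in_itv/= andbT.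
  have AE : A = Z `|` U.
    apply/seteqP; split => x.
      move=> /Aval[Dx]; rewrite le_eqVlt => /predU1P[h0x|hx].
        by left; split => //=; rewrite -h0x.
      by right; apply/Uval.
    by case=> [[Dx /= hx]|/Uval [Dx /ltW hx]]; apply/Aval; rewrite ?hx.
  have ZU : Z `&` U = set0.
    by apply/seteqP; split => x // [[_ /= hx] /Uval[_]]; rewrite hx ltxx.
  have U0 : mu U = 0%E.
    apply: (@Rintegral0_null _ _ _ _ _ h) => //; first by move=> x /Uval[].
    move: h0; rewrite splitA// (Rintegral_null mA' A'0 hb) addr0 AE.
    rewrite Rintegral_disjU// (_ : \int[mu]_(x in Z) h x = 0) ?add0r//.
    rewrite (@eq_Rintegral _ _ _ mu Z (cst 0)); last by move=> x /set_mem[].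
    by rewrite Rintegral_cst ?mul0r.
  have [|i|s [sD spos s0]] := IH d X mu Z f' mZ _ fb'.
  - by move: D0; rewrite DE muU// A'0 adde0 AE muU// U0 adde0.
  - rewrite -[RHS](f0 (lift ord0 i)) splitA// (Rintegral_null mA' A'0 (fb _)) addr0 AE.
    by rewrite Rintegral_disjU// (Rintegral_null mU U0 (fb _)) addr0.
  exists s; split => [p /sD[-> []]//|//|i].
  have [j ->|->] := unliftP ord0 i; first exact: s0.
  by rewrite big_seq big1// => p /sD[_ [_ hp]]; rewrite (hp : f ord0 p.2 = 0) mulr0.
(* A null [A] is impossible: [- h] would be positive on [A'] with zero integral, making [A'] null
   too. *)
have [A0|Apos] := eqVneq (mu A) 0%E.
  suff : mu A' = 0%E by move/eqP; rewrite (negbTE A'pos).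
  apply: (@Rintegral0_null _ _ _ _ _ (fun x => - h x)) => //.
  - exact: bmeasN.
  - by move=> x /A'val[_]; rewrite oppr_gt0.
  - move: h0; rewrite splitA// (Rintegral_null mA A0 hb) add0r => hA'.
    under eq_Rintegral do rewrite -mulN1r.
    rewrite RintegralZl// ?hA' ?mulr0//; exact: bmeas_integrable.
pose F i (z : X * X) := (- h z.2) * f' i z.1 + h z.1 * f' i z.2.
have c0 : \int[mu]_(x in A) h x + \int[mu]_(x in A') h x = 0 by rewrite -splitA.
have h1 : bounded_measurable (fun z : X * X => h z.1).
  exact: (bmeas_comp (@measurable_fst _ _ _ _) hb).
have h2 : bounded_measurable (fun z : X * X => - h z.2).
  exact: bmeasN (bmeas_comp (@measurable_snd _ _ _ _) hb).
have f1 i : bounded_measurable (fun z : X * X => f' i z.1).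
  exact: (bmeas_comp (@measurable_fst _ _ _ _) (fb' i)).
have f2 i : bounded_measurable (fun z : X * X => f' i z.2).
  exact: (bmeas_comp (@measurable_snd _ _ _ _) (fb' i)).
have mAA' : measurable (A `*` A') by exact: measurableX.
have [||i|s [sD [r rs r0] s0]] := IH _ _ (mu \x mu)%E (A `*` A') F mAA'.
- by rewrite [X in (_ < X)%E]product_measure1E// mule_gt0// lt0e ?Apos ?A'pos/=.
- by move=> i; apply: bmeasD; exact: bmeasM.
(* By Fubini, and since the integral of [- h] over [A'] equals that of [h] over [A], the mean of
   [F i] is the integral of [h] over [A] times that of [f' i] over [D], hence zero. *)
- rewrite /F RintegralD//; last 2 first.
    by apply: bmeas_integrable => //; exact: bmeasM.
    by apply: bmeas_integrable => //; exact: bmeasM.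
  rewrite (Rintegral_prodM _ _ mA mA' hb (fb' i)).
  under eq_Rintegral do rewrite mulrC.
  rewrite (Rintegral_prodM _ _ mA mA' (fb' i) (bmeasN hb)).
  under [X in _ * X + _]eq_Rintegral do rewrite -mulN1r.
  rewrite RintegralZl//; last exact: bmeas_integrable.
  rewrite mulN1r (_ : - _ = \int[mu]_(x in A) h x); last first.
    by apply/eqP; rewrite eq_sym -addr_eq0 c0.
  by rewrite mulrC -mulrDr -splitA// f0 mulr0.
(* An atom at [(x, y)] of weight [c] splits into one at [x] of weight [- c * h y] and one at [y] of
   weight [c * h x]. Only the first is sure to stay positive, since [h] may vanish on [A] but not on
   [A']. *)
exists ([seq (p.1 * - h p.2.2, p.2.1) | p <- s] ++
        [seq (p.1 * h p.2.1, p.2.2) | p <- s]); split.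
- move=> p; rewrite mem_cat => /orP[] /mapP[[c [x y]] /sD /=].
    move=> [c0' [/Aval[Dx hx] /A'val[Dy hy]]] -> /=.
    by rewrite mulr_ge0// oppr_ge0 ltW.
  by move=> [c0' [/Aval[Dx hx] /A'val[Dy _]]] -> /=; rewrite mulr_ge0.
- exists (r.1 * - h r.2.2, r.2.1).
    by rewrite mem_cat; apply/orP; left; apply/mapP; exists r.
  by rewrite /= mulr_gt0// oppr_gt0; have [_ [_ /A'val[]]] := sD _ rs.
- move=> i; rewrite big_cat/= !big_map/= -big_split/=.
  have [j ->|->] := unliftP ord0 i.
    by rewrite -[RHS](s0 j); apply: eq_bigr => p _; rewrite /F mulrDr !mulrA.
  by apply: big1 => p _; rewrite -!mulrA mulNr mulrN [h _ * _ in X in - X]mulrC addNr.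
Qed.

(** As long as the support of [q] has more than [n] indices, the rows of [M] that it selects are
    linearly dependent. Moving [q] along a dependence until a first coordinate reaches zero shrinks
    the support and preserves [q *m M]. *)
Lemma conic_caratheodory (R : realFieldType) K n (M : 'M[R]_(K, n))
    (q : 'rV[R]_K) : (forall k, 0 <= q 0 k) ->
  exists q' : 'rV[R]_K, [/\ forall k, 0 <= q' 0 k, q' *m M = q *m M &
    (#|[set k | (q' 0 k != 0)%R]%SET| <= n)%N].
Proof.
have [m] := ubnP #|[set k | (q 0 k != 0)%R]%SET|; elim: m q => // m IH q lem q0.
set S := [set k | q 0 k != 0]%SET in lem.
have [Sn|nS] := leqP #|S| n; first by exists q.
have [c cM [cS [k0 ck0]]] : exists2 c : 'rV[R]_K, c *m M = 0 &
    (forall k, k \notin S -> c 0 k = 0) /\ exists k, 0 < c 0 k.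
  pose N := rowsub (enum_val : 'I_#|S| -> _) M.
  have /rowV0Pn[c' /sub_kermxP c'N c'0] : kermx N != 0.
    by rewrite kermx_eq0 -row_leq_rank -ltnNge (leq_ltn_trans (rank_leq_col N)).
  pose c := \row_k \sum_(i | enum_val i == k) c' 0 i.
  have cE i : c 0 (enum_val i) = c' 0 i.
    rewrite mxE (big_pred1 i)// => j; exact: inj_eq enum_val_inj j i.
  have cS k : k \notin S -> c 0 k = 0.
    by move=> kS; rewrite mxE big_pred0// => i; apply: contraNF kS => /eqP <-; exact: enum_valP.
  have cM : c *m M = 0.
    rewrite -c'N; apply/rowP => j; rewrite !mxE (bigID (mem S))/= addrC big1 ?add0r; last first.
      by move=> k /cS ->; rewrite mul0r.
    by rewrite big_enum_val/=; apply: eq_bigr => i _; rewrite cE !mxE.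
  (* A dependence may be negated, so some coordinate can be taken positive. *)
  have /rV0Pn[i c'i] := c'0; rewrite -cE in c'i.
  have [ci|ci] := ltP 0 (c 0 (enum_val i)).
    by exists c => //; split => //; exists (enum_val i).
  exists (- c); first by rewrite mulNmx cM oppr0.
  split; first by move=> k kS; rewrite mxE cS ?oppr0.
  by exists (enum_val i); rewrite mxE oppr_gt0 lt_neqAle c'i.
(* The least ratio is the longest step that keeps all coordinates nonnegative; it annihilates
   coordinate [k1]. *)
case: (@Order.TotalTheory.arg_minP _ _ _ k0 (fun k => 0 < c 0 k)
  (fun k => q 0 k / c 0 k) ck0) => k1 ck1 min1.
set t := q 0 k1 / c 0 k1 in min1.
have t0 : 0 <= t by rewrite divr_ge0// ltW.
have [|k|q' [q'0 q'M q'n]] := IH (q - t *: c).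
- rewrite -ltnS (leq_trans _ lem)// ltnS; apply: proper_card; apply/properP; split.
    apply/fintype.subsetP => k; rewrite !inE !mxE; apply: contraNN => /eqP qk.
    by rewrite qk cS ?mulr0 ?subr0// inE qk eqxx.
  exists k1; last by rewrite !inE !mxE divfK ?subrr ?eqxx// gt_eqF.
  by apply: contraTT ck1 => /cS ->; rewrite ltxx.
- rewrite !mxE subr_ge0; have [ck|ck] := ltP 0 (c 0 k).
    by rewrite -ler_pdivlMr// min1.
  by rewrite (le_trans _ (q0 k))// mulr_ge0_le0.
by exists q'; split=> //; rewrite q'M mulmxBl -scalemxAl cM scaler0 subr0.
Qed.

(** Centering [f] at its mean gives atoms by [zero_mean_atoms], whose weights are divided by their
    sum [W]. The conic reduction is then run on the vectors [(1, f (x k))] of length [n.+1], whence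
    the bound on [K]. *)
Lemma mean_in_hull (R : realType) d (X : measurableType d)
    (mu : probability X R) n (f : 'I_n -> X -> R) :
  (forall i, bounded_measurable (f i)) ->
  exists K (q : 'I_K -> R) (x : 'I_K -> X),
    [/\ (1 <= K <= n.+1)%N, simplex q &
        forall i, \sum_k q k * f i (x k) = \int[mu]_x f i x].
Proof.
move=> fb; pose m i := \int[mu]_x f i x.
have [|i|i|s [s_ge0 [r rs r0] s0]] :=
    @zero_mean_atoms R n _ X mu setT (fun i x => f i x - m i) measurableT.
- by rewrite [mu _]probability_setT.
- exact: bmeasD (fb i) (bmeas_cst _ (- m i)).
- rewrite RintegralB//.
  + by rewrite Rintegral_prob_cst subrr.
  + exact: bmeas_integrable.
  + by apply: bmeas_integrable => //; exact: bmeas_cst.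
pose W := \sum_(p <- s) p.1.
have W0 : 0 < W.
  rewrite /W big_seq lt0r sumr_ge0 ?andbT; last by move=> p /s_ge0[].
  rewrite psumr_neq0; last by move=> p /s_ge0[].
  by apply/hasP; exists r => //; rewrite rs.
pose x k := (nth r s k).2.
(* The constant column keeps the total mass of the weights. *)
pose M : 'M[R]_(size s, n.+1) :=
  \matrix_(k, j) if unlift ord0 j is Some i then f i (x k) else 1.
pose q := \row_(k < size s) ((nth r s k).1 / W).
have [|q' [q'0 q'M q'n]] := @conic_caratheodory R _ _ M q.
  move=> k; rewrite mxE divr_ge0//; last exact: ltW.
  by have [] := s_ge0 _ (mem_nth r (ltn_ord k)).
have sumS (F : R * X -> R) : \sum_(k < size s) F (nth r s k) = \sum_(p <- s) F p.
  by rewrite (big_nth r) big_mkord.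
have q'1 : \sum_k q' 0 k = 1.
  move/rowP/(_ ord0): q'M; rewrite !mxE.
  under eq_bigr do rewrite mxE unlift_none mulr1.
  move=> ->; under eq_bigr do rewrite !mxE unlift_none mulr1.
  by rewrite (sumS (fun p => p.1 / W)) -mulr_suml divff// gt_eqF.
have q'f i : \sum_k q' 0 k * f i (x k) = m i.
  move/rowP/(_ (lift ord0 i)): q'M; rewrite !mxE.
  under eq_bigr do rewrite mxE liftK.
  move=> ->; under eq_bigr do rewrite !mxE liftK.
  rewrite (sumS (fun p => p.1 / W * f i p.2)).
  have := s0 i; under eq_bigr do rewrite mulrBr.
  rewrite sumrB -mulr_suml -/W => /eqP; rewrite subr_eq0 => /eqP sf.
  under eq_bigr do rewrite mulrAC.
  by rewrite -mulr_suml sf mulrAC divff ?mul1r// gt_eqF.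
(* Discarding the zero weights and renumbering the rest by [enum_val] leaves at most [n.+1]
   points. *)
pose S := [set k | (q' 0 k != 0)%R]%SET.
have sumE (F : 'I_(size s) -> R) :
    \sum_(k < #|S|) q' 0 (enum_val k) * F (enum_val k) = \sum_k q' 0 k * F k.
  rewrite -(big_enum_val (fun k => q' 0 k * F k)) [RHS](bigID (mem S))/=.
  rewrite [X in _ + X]big1 ?addr0// => k; rewrite inE negbK => /eqP ->.
  by rewrite mul0r.
have sum1 : \sum_(k < #|S|) q' 0 (enum_val k) = 1.
  rewrite -q'1; under eq_bigr do rewrite -[q' _ _]mulr1.
  by rewrite (sumE (cst 1)); apply: eq_bigr => k _; rewrite mulr1.
pose e (k : 'I_#|S|) := enum_val k.
exists #|S|, (fun k => q' 0 (e k)), (fun k => x (e k)); split.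
- rewrite q'n andbT lt0n; apply/negP => /eqP/card0_eq S0.
  have /eqP := sum1; rewrite big1 ?(eq_sym 0) ?oner_eq0// => k _.
  by have := S0 (enum_val k); rewrite enum_valP.
- split => // k; rewrite q'0/= -sum1 (bigD1 k)//= lerDl.
  by apply: sumr_ge0 => j _.
- by move=> i; rewrite (sumE (fun k => f i (x k))).
Qed.

(** * Finitely supported laws and spans of maximal independent families *)

Lemma atomic_probability (R : realType) d (X : measurableType d) K
    (q : 'I_K.+1 -> R) (x : 'I_K.+1 -> X) : simplex q ->
  exists Q : probability X R, forall f : X -> R, measurable_fun [set: X] f ->
    (forall y, 0 <= f y) ->
    (\int[Q]_y (f y)%:E = (\sum_k q k * f (x k))%:E)%E.
Proof.
move=> [q01 q1]; have q0 k : 0 <= q k by case/andP: (q01 k).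
(* [msum] sums a sequence indexed by [nat]; [inord] is the identity on the first [K.+1] indices, the
   only ones summed. *)
pose m (k : nat) : {measure set X -> \bar R} :=
  mscale (NngNum (q0 (inord k))) (dirac (x (inord k))).
have intE (f : X -> R) : measurable_fun [set: X] f -> (forall y, 0 <= f y) ->
    (\int[msum m K.+1]_y (f y)%:E = (\sum_k q k * f (x k))%:E)%E.
  move=> mf f0; rewrite ge0_integral_measure_sum//; last first.
  - exact/measurable_EFinP.
  - by move=> y _; rewrite lee_fin.
  rewrite -sumEFin; apply: eq_bigr => k _.
  rewrite ge0_integral_mscale//; last first.
  - by move=> y _; rewrite lee_fin.
  - exact/measurable_EFinP.
  rewrite integral_dirac//; last exact/measurable_EFinP.
  by rewrite diracT mul1e /= inord_val.
have mT : msum m K.+1 [set: X] = 1%E.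
  have := intE (cst 1) (measurable_cst _) (fun=> ler01).
  rewrite (_ : (fun=> _) = cst 1%E)// integral_cst// mul1e => ->; congr EFin; rewrite -[RHS]q1.
  by apply: eq_bigr => k _; rewrite /= mulr1.
pose Q : probability X R :=
  HB.pack (msum m K.+1) (Measure_isProbability.Build _ _ _ (msum m K.+1) mT).
by exists Q.
Qed.

(** By maximality [v :: vs] is dependent. The coefficient of [v] in a nontrivial relation is
    nonzero, as otherwise [vs] would be dependent, so the relation can be solved for [v]. *)
Lemma max_indep_span (F : fieldType) (V : lmodType F) (S : set V) (vs : seq V)
    (v : V) : max_indep_card S (size vs) -> (forall w, w \in vs -> S w) ->
  lin_indep vs -> S v ->
  exists c : 'I_(size vs) -> F, v = \sum_i c i *: vs`_i.
Proof.
move=> [_ max_vs] vsS vs_indep Sv.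
have [c [cv [i ci]]] : exists c : 'I_(size (v :: vs)) -> F,
    \sum_i c i *: (v :: vs)`_i = 0 /\ exists i, c i <> 0.
  have vvs_dep : ~ lin_indep (v :: vs).
    move=> vvs_indep; suff : (size (v :: vs) <= size vs)%N by rewrite ltnn.
    by apply: max_vs vvs_indep => w; rewrite inE => /predU1P[->|/vsS].
  move/existsNP: vvs_dep => [c /not_implyP[cv /existsNP ci]].
  by exists c.
rewrite /= big_ord_recl/= in cv.
have [c0|c0] := eqVneq (c ord0) 0.
  rewrite c0 scale0r add0r in cv.
  have cz := vs_indep (fun j => c (lift ord0 j)) cv.
  by have [j ij|i0] := unliftP ord0 i; case: ci; [rewrite ij cz|rewrite i0].
exists (fun j => - (c ord0)^-1 * c (lift ord0 j)).
under eq_bigr do rewrite -scalerA; rewrite -scaler_sumr.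
move/eqP: cv; rewrite addrC addr_eq0 => /eqP ->.
by rewrite scalerN scaleNr opprK scalerA mulVf// scale1r.
Qed.

(** * Choice probabilities and cell integrals *)

Section choice_model.
Context (R : realType) d (B : measurableType d) (J T N : nat)
  (s : choice_kernel R B J T) (a : 'I_N -> menu J T).
Implicit Types (Q : probability B R)
  (P : probability (N.-tuple (profile J T)) R).

Lemma ck_bounded_measurable (m : menu J T) y :
  bounded_measurable (fun b => s (b, m, y)).
Proof.
split; last by exists 1 => b; rewrite ger0_norm ?ck_le1 ?ck_ge0.
apply: (@measurableT_comp _ _ _ _ _ _ s _ (fun b => (b, m, y))).
  exact: ck_measurable.
by apply: measurable_fun_pair => //; exact: measurable_fun_pair.
Qed.

Lemma integral_ckE Q (m : menu J T) y :
  (\int[Q]_b (s (b, m, y))%:E = (\int[Q]_b s (b, m, y))%R%:E)%E.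
Proof.
rewrite /Rintegral fineK//; apply: (integrable_fin_num measurableT).
exact: (bmeas_integrable Q measurableT (ck_bounded_measurable m y)).
Qed.

Lemma pair_law_choice Q (m : menu J T) y :
  pair_law s Q m (snd @^-1` [set y]) = (\int[Q]_b (s (b, m, y))%:E)%E.
Proof.
apply: eq_integral => b _; congr EFin.
rewrite /section_mass (bigD1 y)//= big1 ?addr0.
  by rewrite indicE mem_set// mulr1.
by move=> z zy; rewrite indicE memNset ?mulr0//=; apply/eqP.
Qed.

(** The event that the [i]-th choice is [y] is a rectangle [C] whose other sides are the whole
    space, so only the [i]-th factor of the product law remains. *)
Lemma generates_marginal Q P i y : generates s a Q P ->
  pushforward P (fun z => tnth z i) [set y] =
  (\int[Q]_b (s (b, a i, y))%:E)%E.
Proof.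
move=> gen; rewrite /pushforward -gen; last first.
  by rewrite -[X in measurable X]setTI; exact: measurable_tnth.
rewrite /choice_marginal /pushforward.
pose C j : set (B * profile J T) := if j == i then snd @^-1` [set y] else setT.
rewrite (_ : _ @^-1` _ = [set w | forall j, C j (tnth w j)]); last first.
  apply/seteqP; split => w /=; rewrite tnth_mktuple /C.
    by move=> wi j; case: eqP => // ->.
  by move/(_ i); rewrite eqxx.
rewrite /full_law indep_law_rect; last first.
  move=> j; rewrite /C; case: ifP => // _.
  by rewrite -[X in measurable X]setTI; exact: measurable_snd.
rewrite (bigD1 i)//= big1 ?mule1; last first.
  by move=> j /negbTE ji; rewrite /C ji; exact: (probability_setT (pair_law s Q (a j))).
by rewrite /C eqxx pair_law_choice.
Qed.

(** Individuals facing the same menu have the same marginal, so averaging returns it; membership in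
    the design makes the number of averaged terms nonzero. *)
Lemma generates_Qnp Q P m y : generates s a Q P -> m \in codom a ->
  Qnp a P (m, y) = \int[Q]_b s (b, m, y).
Proof.
move=> gen /codomP[i0 mi0]; rewrite /Qnp/=.
under eq_bigr => i /eqP im do rewrite (generates_marginal _ _ gen) im -/(Rintegral _ _ _).
rewrite sumr_const -[X in _ * X]mulr_natl mulrA.
rewrite (_ : #|[pred i | a i == m]| = #|[set i | a i == m]%SET|); last first.
  by apply: eq_card => i; rewrite !inE.
rewrite mulVf ?mul1r// pnatr_eq0 -lt0n card_gt0; apply/set0Pn; exists i0.
by rewrite inE mi0.
Qed.

(** There are finitely many choice tuples, so the law is determined by its singleton masses, and
    these are products of cell integrals. *)
Lemma generates_eq Q Q' P :
  (forall i y, \int[Q]_b s (b, a i, y) = \int[Q']_b s (b, a i, y)) ->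
  generates s a Q P -> generates s a Q' P.
Proof.
move=> QQ' gen A mA; rewrite -gen// /choice_marginal /pushforward.
set Y := fun w : N.-tuple (B * profile J T) => [tuple (tnth w i).2 | i < N].
have mY y : measurable (Y @^-1` [set y]).
  rewrite (_ : _ @^-1` _ = \bigcap_(i in [set: 'I_N])
      ((fun w => (tnth w i).2) @^-1` [set tnth y i])).
    apply: fin_bigcap_measurable => // i _; rewrite -[X in measurable X]setTI.
    by apply: (measurableT_comp measurable_snd (measurable_tnth i)).
  apply/seteqP; split => w /=.
    by move=> <- i _; rewrite /Y /= tnth_mktuple.
  by move=> h; apply/eq_from_tnth => i; rewrite tnth_mktuple h.
have YA : Y @^-1` A = \bigcup_(y in A) (Y @^-1` [set y]).
  rewrite -preimage_bigcup; congr (_ @^-1` _).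
  by apply/seteqP; split => [y Ay|y [z Az ->]]//; exists y.
rewrite YA !measure_fin_bigcup//; do ?[exact: finite_finset]; do ?[exact: trivIset_preimage1].
- apply: eq_fsbigr => y _.
  apply: (etrans (choice_marginalE s a Q' y)).
  apply/esym/(etrans (choice_marginalE s a Q y)).
  by apply: eq_bigr => i _; rewrite !integral_ckE QQ'.
Qed.

End choice_model.

(** This makes every cell integral an affine function of the first [Lt] moments, because a
    probability integrates the constant [1] to [1]. *)
Lemma moment_span (R : realType) d (B : measurableType d) (J T N : nat)
    (s : choice_kernel R B J T) (a : 'I_N -> menu J T)
    (o : 'I_#|design_cells a| -> menu J T * profile J T) Lt
    (hLt : (Lt <= #|design_cells a|)%N) l : basis_ordering s o hLt ->
  exists (c0 : R) (c : 'I_Lt -> R), forall b, moment_fun s o l b =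
    c0 + \sum_j c j * moment_fun s o (widen_ord hLt j) b.
Proof.
move=> [max_card indep]; set ts := [seq _ | j <- enum 'I_Lt] in indep.
have ts_size : size ts = Lt by rewrite size_map size_enum_ord.
have [c tE] : exists c : 'I_(size ((cst 1 : B -> R) :: ts)) -> R,
    moment_fun s o l = \sum_i c i *: ((cst 1 : B -> R) :: ts)`_i.
  apply: (max_indep_span _ _ indep); rewrite /= ?ts_size; first exact: max_card.
    move=> w; rewrite inE => /predU1P[->|/mapP[j _ ->]]; first by left.
    by right; exists (widen_ord hLt j).
  by right; exists l.
rewrite big_ord_recl/= in tE.
exists (c ord0), (fun j => c (lift ord0 (cast_ord (esym ts_size) j))) => b.
rewrite tE /=; congr (_ + _); first exact: mulr1.
rewrite (reindex (cast_ord (esym ts_size)))/=; last first.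
  by exists (cast_ord ts_size) => j _; rewrite ?cast_ordK ?cast_ordKV.
rewrite fct_sumE; apply: eq_bigr => j _.
by rewrite /= add0n (nth_map j) ?size_enum_ord// nth_ord_enum.
Qed.

(** * Equality of the two suprema *)

Theorem theorem5 (R : realType) (d : measure_display) (B : measurableType d)
    (J T N : nat) (hN : (0 < N)%N)
    (a : 'I_N -> menu J T)
    (s : choice_kernel R B J T)
    (g : B -> R) (hg : measurable_fun [set: B] g)
    (hg01 : forall b, 0 <= g b <= 1)
    (o : 'I_#|design_cells a| -> menu J T * profile J T)
    (ho : is_ordering o)
    (Lt : nat) (hLt : (Lt <= #|design_cells a|)%N)
    (hbasis : basis_ordering s o hLt)
    (P : probability (N.-tuple (profile J T)) R)
    (hP : P (choice_space a) = 1%E)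
    (hreal : realizable s a P) :
  Psi_plus s a g P =
  ereal_sup [set v : \bar R |
    exists (K : nat) (q : 'I_K -> R) (beta : 'I_K -> B),
      candidate s o hLt P q beta /\
      v = (\sum_(k < K) q k * g (beta k))%:E].
Proof.
have g0 b : 0 <= g b by case/andP: (hg01 b).
have gb : bounded_measurable g.
  by split => //; exists 1 => b; rewrite ger0_norm//; case/andP: (hg01 b).
pose t l := moment_fun s o (widen_ord hLt l).
have tb l : bounded_measurable (t l) by exact: ck_bounded_measurable.
have bE Q l : generates s a Q P -> bN o hLt P l 0 = \int[Q]_b t l b.
  move=> gen; rewrite mxE [X in Qnp _ _ X]surjective_pairing (generates_Qnp _ gen)//.
  have : o (widen_ord hLt l) \in design_cells a.
    by rewrite -ho.2; exact: codom_f.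
  by rewrite inE => /andP[].
(* The two sets of attained values already coincide. *)
congr ereal_sup; apply/seteqP; split => v.
- move=> [Q gen <-].
  (* Placing [g] in front of the moments gives [Lt.+1] functions, hence at most [Lt + 2] points. *)
  pose f (j : 'I_Lt.+1) := if unlift ord0 j is Some l then t l else g.
  have [|K [q [beta [K2 q1 qf]]]] := @mean_in_hull _ _ _ Q _ f.
    by move=> j; rewrite /f; case: unliftP.
  exists K, q, beta; split; last first.
    have := qf ord0; rewrite /f unlift_none => ->.
    rewrite /Rintegral fineK//; apply: (integrable_fin_num measurableT).
    exact: (bmeas_integrable Q measurableT gb).
  split => //; first by rewrite addn2.
  apply/colP => l; rewrite (bE Q)// summxE.
  have := qf (lift ord0 l); rewrite /f liftK => <-.
  by apply: eq_bigr => k _; rewrite !mxE.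
move=> [[|K] [q [beta [[K2 q1 qt] ->]]]]//.
have [Q' Q'E] := atomic_probability beta q1.
exists Q'; last by rewrite Q'E.
(* Realizability provides a law [Q] generating [P]; [Q'] generates [P] too once its cell integrals
   are shown to equal those of [Q]. *)
have [Q gen] := hreal; apply: (generates_eq _ gen) => i y.
have QQ' l : \int[Q]_b t l b = \int[Q']_b t l b.
  rewrite -(bE Q)// -qt summxE /Rintegral Q'E; last 2 first.
  - by case: (tb l).
  - by move=> b; exact: ck_ge0.
  by apply: eq_bigr => k _; rewrite !mxE.
(* Outside the menu the kernel is zero and both integrals vanish; inside it, [(a i, y)] is a design
   cell and so is listed by [o]. *)
have [ya|ya] := boolP (y \in (a i : {set _})); last first.
  by rewrite /Rintegral !integral0_eq// => b _; rewrite ck_out.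
have /codomP[l lE] : (a i, y) \in codom o by rewrite ho.2 inE /= codom_f.
have [c0 [c tE]] := moment_span l hbasis.
have intE (Q0 : probability B R) : \int[Q0]_b s (b, a i, y) =
    c0 + \sum_j c j * \int[Q0]_b t j b.
  rewrite -Rintegral_affine//; apply: eq_Rintegral => b _; rewrite -tE.
  by rewrite /moment_fun -lE.
by rewrite !intE; congr (_ + _); apply: eq_bigr => j _; rewrite QQ'.
Qed.
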